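(* The problem Maximum Disconnected Perfect Matching is solvable in polynomial time on bipartite graphs of radius at most $2$.
   Context: Graphs are finite, simple and undirected. The distance $\mathrm{dist}(u,v)$ is the length of a shortest path from $u$ to $v$; a graph has radius at most $r$ if there is a vertex $v$ such that $\mathrm{dist}(v,u)\le r$ for all vertices $u$ (in particular such a graph is connected). A matching $M\subseteq E(G)$ is a set of pairwise non-adjacent edges; it is perfect if every vertex of $G$ is incident to an edge of $M$. A matching $M$ is a matching cut of $G$ if there is a partition of $V(G)$ into two non-empty sets $A$ and $B$ such that the edges of $M$ are exactly the edges of $G$ with one endvertex in $A$ and one in $B$. The size of a matching cut is its number of edges. A disconnected perfect matching of $G$ is a matching cut of $G$ that is contained in some perfect matching of $G$; its size is its size as a matching cut (the number of edges of the cut, not of the perfect matching). The problem Maximum Disconnected Perfect Matching takes a graph $G$ as input and asks for the maximum size of a disconnected perfect matching of $G$ (or to report that $G$ has none). *)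

(* Defs.v *)
From mathcomp Require Import all_boot.
Set Implicit Arguments.
Unset Strict Implicit.
Unset Printing Implicit Defensive.

Record sgraph (T : finType) := SGraph {
  adj :> rel T;
  adj_sym : symmetric adj;
  adj_irr : irreflexive adj }.

Section Graphs.
Variables (T : finType) (G : sgraph T).
Implicit Types (u v : T) (A : {set T}) (M P : {set {set T}}).

Definition edges : {set {set T}} :=
  [set [set p.1; p.2] | p : T * T & G p.1 p.2].

(* [p] lists the vertices of the path after [u], so [size p] is its length. *)
Definition is_path u v (p : seq T) : bool :=
  [&& path G u p, last u p == v & uniq (u :: p)].

Definition is_dist u v (d : nat) : Prop :=
  (exists2 p, is_path u v p & size p = d) /\
  (forall p, is_path u v p -> d <= size p).

Definition radius_at_most (r : nat) : Prop :=
  exists v, forall u, exists2 d, is_dist v u d & d <= r.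

Definition bipartite : Prop :=
  exists A, forall u v, G u v -> (u \in A) != (v \in A).

Definition matching M : bool := (M \subset edges) && trivIset M.

Definition perfect_matching M : bool := matching M && (cover M == [set: T]).

Definition cut_edges A : {set {set T}} :=
  [set [set p.1; p.2] | p : T * T & [&& G p.1 p.2, p.1 \in A & p.2 \notin A]].

(* The two sides of the partition are [A] and its complement. *)
Definition matching_cut M : bool :=
  matching M &&
  [exists A : {set T}, [&& A != set0, ~: A != set0 & M == cut_edges A]].

Definition disconnected_perfect_matching M : bool :=
  matching_cut M &&
  [exists P : {set {set T}}, perfect_matching P && (M \subset P)].

(* [None] stands for the report that [G] has no disconnected perfect
   matching. *)
Definition max_disconnected_perfect_matching (r : option nat) : Prop :=
  match r with
  | None => forall M, ~~ disconnected_perfect_matching M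
  | Some k =>
      (exists2 M, disconnected_perfect_matching M & #|M| = k) /\
      (forall M, disconnected_perfect_matching M -> #|M| <= k)
  end.

End Graphs.

(* Model of computation: a unit-cost random access machine with structured
   control flow.  A program uses registers, named by constants, and a heap,
   addressed by the contents of registers; both hold natural numbers.  The only
   arithmetic is addition and truncated subtraction, so a number computed in
   [t] steps is at most [t] bits longer than the largest initial number or
   program constant; without a multiplication instruction, polynomial time on
   this machine is polynomial time on Turing machines. *)
Inductive cmd : Type :=
  | Skip
  | Const (x k : nat)             (* x := k *)
  | Add (x y z : nat)             (* x := y + z *)
  | Sub (x y z : nat)             (* x := y - z *)
  | Read (x y : nat)              (* x := heap[y] *)
  | Write (x y : nat)            (* heap[x] := y *)
  | Seq (c1 c2 : cmd)
  | If (x : nat) (c1 c2 : cmd)    (* tests x <> 0 *)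
  | While (x : nat) (c : cmd).    (* tests x <> 0 *)

Record state := State { reg : nat -> nat; heap : nat -> nat }.

Definition update (f : nat -> nat) (a v : nat) : nat -> nat :=
  fun b => if b == a then v else f b.

Definition set_reg (s : state) (x v : nat) : state :=
  State (update (reg s) x v) (heap s).

Definition set_heap (s : state) (a v : nat) : state :=
  State (reg s) (update (heap s) a v).

(* [exec c s t s']: started in [s], the program [c] halts in [s'] after exactly
   [t] steps; every elementary instruction and every test is one step. *)
Inductive exec : cmd -> state -> nat -> state -> Prop :=
  | exec_Skip s : exec Skip s 1 s
  | exec_Const s x k : exec (Const x k) s 1 (set_reg s x k)
  | exec_Add s x y z : exec (Add x y z) s 1 (set_reg s x (reg s y + reg s z))
  | exec_Sub s x y z : exec (Sub x y z) s 1 (set_reg s x (reg s y - reg s z))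
  | exec_Read s x y : exec (Read x y) s 1 (set_reg s x (heap s (reg s y)))
  | exec_Write s x y : exec (Write x y) s 1 (set_heap s (reg s x) (reg s y))
  | exec_Seq c1 c2 s1 t1 s2 t2 s3 :
      exec c1 s1 t1 s2 -> exec c2 s2 t2 s3 ->
      exec (Seq c1 c2) s1 (t1 + t2) s3
  | exec_IfT x c1 c2 s t s' :
      reg s x != 0 -> exec c1 s t s' -> exec (If x c1 c2) s t.+1 s'
  | exec_IfF x c1 c2 s t s' :
      reg s x = 0 -> exec c2 s t s' -> exec (If x c1 c2) s t.+1 s'
  | exec_WhileF x c s : reg s x = 0 -> exec (While x c) s 1 s
  | exec_WhileT x c s1 t1 s2 t2 s3 :
      reg s1 x != 0 -> exec c s1 t1 s2 -> exec (While x c) s2 t2 s3 ->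
      exec (While x c) s1 (t1 + t2).+1 s3.

(* Register 0 holds the number [n] of vertices, heap cell [i * n + j] holds the
   entry [(i, j)] of the adjacency matrix, and everything else is 0. *)
Definition graph_input (n : nat) (G : sgraph 'I_n) : state :=
  State (fun x => if x == 0 then n else 0)
        (fun a => [exists i : 'I_n, exists j : 'I_n,
                    (a == i * n + j) && G i j] : nat).

(* Register 0 tells whether there is an answer, register 1 holds the answer. *)
Definition output (s : state) : option nat :=
  if reg s 0 == 0 then None else Some (reg s 1).

(* The function problem [answer], restricted to input graphs in [class], is
   solved by one program, for all [n], in time polynomial in [n]; nothing is
   required of the program on graphs outside [class]. *)
Definition solvable_in_polynomial_time
    (class : forall n, sgraph 'I_n -> Prop)
    (answer : forall n, sgraph 'I_n -> option nat -> Prop) : Prop :=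
  exists (prog : cmd) (a k : nat),
    forall (n : nat) (G : sgraph 'I_n), class n G ->
      exists (t : nat) (s : state),
        [/\ exec prog (graph_input G) t s, t <= a * n ^ k + a
          & answer n G (output s)].

(* Main.v *)
Require Import Defs.
From mathcomp Require Import all_boot.
From mathcomp Require Import zify.
(* Makes the machine instructions visible again, [Add] in particular. *)
Import Defs.

(** Let [v] be a vertex at distance at most 2 from all others, in a bipartite
    graph [G].  The side opposite to [v] is exactly [N(v)], and every other
    vertex [x <> v] has all its neighbours in [N(v)].  Consider a matching cut
    [M], contained in a perfect matching [P], and let [A] be the side of the cut
    that misses [v].  At most one neighbour [w] of [v] lies in [A].  All
    neighbours of [w] but [v] lie in [A], and any other vertex of [A] outside
    [N(v)] has all its neighbours outside [A], hence is a leaf.  So [A] is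
    contained in the set [candidate v w] made of [w], of its neighbours other
    than [v], and of all leaves at distance 2 from [v].  Conversely the edge of
    a leaf belongs to every perfect matching, so adding the missing leaves keeps
    the cut inside [P]: the cut of [candidate v w] contains [M] and is contained
    in [P] ([candidate_extends_cut]).  If no neighbour of [v] lies in [A], the
    same holds with the leaves alone, which is the candidate of any non-edge
    [v w].  Hence the answer is the largest cut among the [n * n] candidates
    that some perfect matching contains ([max_value]).

    The cut of [B] is contained in a perfect matching iff there is an injective
    map sending each [x] to a neighbour of [x], and to the partner of [x] in the
    cut if it has one ([extendable]).  Such a map is a perfect matching of the
    bipartite double cover of [G]; because [G] is bipartite, the images of one
    side are the other side, so its restriction to one side is a perfect
    matching of [G] ([matching_of_extendable]).  Working with the double cover
    spares the algorithm the computation of a bipartition.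

    The injective map is sought by an auction.  Right vertices carry prices,
    initially 0.  A left vertex without partner takes its cheapest neighbour,
    from the current owner if there is one, and raises its price by 1.  Prices
    are dual variables: an owner never pays more than the price of any of its
    neighbours plus 1, and free right vertices have price 0.  If a solution [f]
    exists, comparing the sum of all prices with the sum of the prices of the
    [f x] shows that an unmatched [x] has a neighbour of price less than [n]
    ([cheap_partner]); so no price exceeds [n], and [n * n] bids suffice
    ([auction_total]).  Whatever the auction returns is checked afterwards.

    The machine program is obtained from a small language whose only loops run
    over [0, ..., n - 1], and whose expressions include sums over that range.
    Every program of that language compiles to a machine program of polynomial
    running time ([loop_program_solves]), so that only its denotation, a
    function on states, remains to be studied ([program_correct]). *)

Set Implicit Arguments.
Unset Strict Implicit.
Unset Printing Implicit Defensive.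

(** * A loop language and its compilation to the machine *)

(** [Sum x e] lets the register [x] range over [0, ..., n - 1].  Together with
    truncated subtraction, sums express Boolean connectives, comparisons,
    bounded quantifiers and multiplication by [n]. *)
Inductive expr : Type :=
  | Num (k : nat)
  | Var (x : nat)
  | Get (e : expr)
  | Plus (e1 e2 : expr)
  | Minus (e1 e2 : expr)
  | Sum (x : nat) (e : expr).

Inductive stmt : Type :=
  | Assign (x : nat) (e : expr)
  | Put (a e : expr)
  | Then (c1 c2 : stmt)
  | When (e : expr) (c : stmt)
  | For (x : nat) (c : stmt).

Fixpoint eval (n : nat) (e : expr) (s : state) : nat :=
  match e with
  | Num k => k
  | Var x => reg s x
  | Get e => heap s (eval n e s)
  | Plus e1 e2 => eval n e1 s + eval n e2 s
  | Minus e1 e2 => eval n e1 s - eval n e2 s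
  | Sum x e => \sum_(i < n) eval n e (set_reg s x i)
  end.

Fixpoint den (n : nat) (c : stmt) (s : state) : state :=
  match c with
  | Assign x e => set_reg s x (eval n e s)
  | Put a e => set_heap s (eval n a s) (eval n e s)
  | Then c1 c2 => den n c2 (den n c1 s)
  | When e c => if eval n e s == 0 then s else den n c s
  | For x c => foldl (fun s i => den n c (set_reg s x i)) s (iota 0 n)
  end.

(** Registers below [m] hold the variables, those from [m] on are scratch space
    for the compiled code; register 0 must keep [n], so it is never assigned. *)
Fixpoint wf_expr (m : nat) (e : expr) : bool :=
  match e with
  | Num _ => true
  | Var x => x < m
  | Get e => wf_expr m e
  | Plus e1 e2 | Minus e1 e2 => wf_expr m e1 && wf_expr m e2
  | Sum x e => (0 < x < m) && wf_expr m e
  end.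

Fixpoint wf_stmt (m : nat) (c : stmt) : bool :=
  match c with
  | Assign x e => (0 < x < m) && wf_expr m e
  | Put a e => wf_expr m a && wf_expr m e
  | Then c1 c2 => wf_stmt m c1 && wf_stmt m c2
  | When e c => wf_expr m e && wf_stmt m c
  | For x c => (0 < x < m) && wf_stmt m c
  end.

(** Register [d] counts down from [n], and [x] is recomputed from it at each turn,
    so that the body may overwrite [x]. *)
Definition loop (d x : nat) (body : cmd) : cmd :=
  Seq (Const d 0) (Seq (Add d 0 d)
    (While d (Seq (Sub x 0 d)
      (Seq body (Seq (Const d.+1 1) (Sub d d d.+1)))))).

(** The value is left in register [d]; registers below [d] are preserved, except
    that [Sum] uses its variable as loop index and then restores it from
    register [d.+1]. *)
Fixpoint comp_expr (d : nat) (e : expr) : cmd :=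
  match e with
  | Num k => Const d k
  | Var x => Seq (Const d 0) (Add d x d)
  | Get e => Seq (comp_expr d e) (Read d d)
  | Plus e1 e2 =>
      Seq (comp_expr d e1) (Seq (comp_expr d.+1 e2) (Add d d d.+1))
  | Minus e1 e2 =>
      Seq (comp_expr d e1) (Seq (comp_expr d.+1 e2) (Sub d d d.+1))
  | Sum x e =>
      Seq (Const d 0) (Seq (Add d.+1 x d)
        (Seq (loop d.+2 x (Seq (comp_expr d.+3 e) (Add d d d.+3)))
          (Seq (Const d.+2 0) (Add x d.+1 d.+2))))
  end.

Fixpoint comp_stmt (d : nat) (c : stmt) : cmd :=
  match c with
  | Assign x e => Seq (comp_expr d e) (Seq (Const d.+1 0) (Add x d d.+1))
  | Put a e => Seq (comp_expr d a) (Seq (comp_expr d.+1 e) (Write d d.+1))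
  | Then c1 c2 => Seq (comp_stmt d c1) (comp_stmt d c2)
  | When e c => Seq (comp_expr d e) (If d (comp_stmt d c) Skip)
  | For x c => loop d x (comp_stmt d.+1 c)
  end.

Definition loop_cost (n T : nat) : nat := n * (T + 4) + 3.

Fixpoint cost_expr (n : nat) (e : expr) : nat :=
  match e with
  | Num _ => 1
  | Var _ => 2
  | Get e => cost_expr n e + 1
  | Plus e1 e2 | Minus e1 e2 => cost_expr n e1 + (cost_expr n e2 + 1)
  | Sum _ e => (loop_cost n (cost_expr n e + 1) + 2).+2
  end.

Fixpoint cost_stmt (n : nat) (c : stmt) : nat :=
  match c with
  | Assign _ e => cost_expr n e + 2
  | Put a e => cost_expr n a + (cost_expr n e + 1)
  | Then c1 c2 => cost_stmt n c1 + cost_stmt n c2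
  | When e c => cost_expr n e + (cost_stmt n c + 2)
  | For _ c => loop_cost n (cost_stmt n c)
  end.

Definition run (c : cmd) (s : state) (T : nat) (Q : state -> Prop) : Prop :=
  exists t s', [/\ exec c s t s', t <= T & Q s'].

Lemma run_last c s s' (Q : state -> Prop) :
  exec c s 1 s' -> Q s' -> run c s 1 Q.
Proof. by move=> ? ?; exists 1, s'. Qed.

Lemma run_step c1 c2 s s1 T Q :
  exec c1 s 1 s1 -> run c2 s1 T Q -> run (Seq c1 c2) s T.+1 Q.
Proof.
move=> h1 [t [s' [h2 le Qs]]]; exists (1 + t), s'; split=> //.
exact: exec_Seq h1 h2.
Qed.

Lemma run_seq c1 c2 s T1 T2 R Q :
  run c1 s T1 R -> (forall s', R s' -> run c2 s' T2 Q) ->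
  run (Seq c1 c2) s (T1 + T2) Q.
Proof.
move=> [t1 [s1 [h1 le1 R1]]] /(_ s1 R1) [t2 [s2 [h2 le2 Q2]]].
by exists (t1 + t2), s2; split=> //; [apply: exec_Seq h1 h2 | apply: leq_add].
Qed.

Lemma run_weaken c s T1 T2 (Q1 Q2 : state -> Prop) :
  run c s T1 Q1 -> T1 <= T2 -> (forall s', Q1 s' -> Q2 s') -> run c s T2 Q2.
Proof.
move=> [t [s' [h le Qs]]] leT QQ; exists t, s'; split=> //; last exact: QQ.
exact: leq_trans le leT.
Qed.

Lemma updateE f a v b : update f a v b = if b == a then v else f b.
Proof. by []. Qed.

(** The rule for counted loops.  The invariant [Q i] must not depend on the
    registers from [d] on, where the loop keeps its counter. *)
Lemma run_loop n d x body T (Q : nat -> state -> Prop) s :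
  x < d -> 0 < x ->
  (forall i s, Q i s -> reg s 0 = n) ->
  (forall i s y v, d <= y -> Q i s -> Q i (set_reg s y v)) ->
  (forall i s, i < n -> Q i s ->
     run body (set_reg s x i) T (fun s' => Q i.+1 s' /\ reg s' d = reg s d)) ->
  Q 0 s -> run (loop d x body) s (loop_cost n T) (Q n).
Proof.
move=> ltxd x0 Qn Qd Qbody Q0.
(* The invariant is read backwards: [k] iterations are left. *)
have main k s1 : k <= n -> reg s1 d = k -> Q (n - k) s1 ->
  run (While d (Seq (Sub x 0 d) (Seq body (Seq (Const d.+1 1) (Sub d d d.+1)))))
    s1 (k * (T + 4) + 1) (Q n).
  elim: k s1 => [|k IH] s1 lek rd Qs.
    by exists 1, s1; split=> //; [apply: exec_WhileF | rewrite -[n]subn0].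
  have rx : reg s1 0 - reg s1 d = n - k.+1 by rewrite rd (Qn _ _ Qs).
  have [|t1 [s2 [e1 le1 [Q2 rd2]]]] := Qbody (n - k.+1) s1 _ Qs; first lia.
  set s3 := set_reg (set_reg s2 d.+1 1) d k.
  have e3 : exec (Seq (Const d.+1 1) (Sub d d d.+1)) s2 (1 + 1) s3.
    apply: exec_Seq; first exact: exec_Const.
    have -> : s3 = set_reg (set_reg s2 d.+1 1) d
      (reg (set_reg s2 d.+1 1) d - reg (set_reg s2 d.+1 1) d.+1).
      by rewrite /s3 /= !updateE eqxx ltn_eqF // rd2 rd subn1.
    exact: exec_Sub.
  have [|||t4 [s4 [e4 le4 Q4]]] := IH s3.
  - lia.
  - by rewrite /s3 /= updateE eqxx.
  - have -> : n - k = (n - k.+1).+1 by lia.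
    by do 2!apply: (Qd) => //.
  exists ((1 + (t1 + (1 + 1))) + t4).+1, s4; split=> //; last lia.
  apply: exec_WhileT e4; first by rewrite rd.
  apply: (exec_Seq (exec_Sub _ _ _ _)); rewrite rx.
  exact: exec_Seq e1 e3.
have -> : loop_cost n T = (n * (T + 4) + 1).+2 by rewrite /loop_cost; lia.
apply: run_step; first exact: exec_Const.
apply: run_step; first exact: exec_Add.
have rn : reg s 0 = n := Qn _ _ Q0.
have d0 : 0 < d by apply: leq_trans ltxd.
apply: main => //; rewrite ?subnn; last by do 2!apply: (Qd) => //.
by rewrite /= !updateE eqxx (ltn_eqF d0) rn addn0.
Qed.

(** Reads registers and heap cells through updates at addresses that [lia] can
    tell apart. *)
Ltac registers :=
  rewrite /= ?updateE ?eqxx;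
  repeat match goal with
  | |- context [?a == ?b] => rewrite (_ : (a == b) = false); last by lia
  end.

(** The actual state [s] simulates the state [S] of the denotational semantics,
    which knows nothing about scratch registers. *)
Definition agree (m : nat) (s S : state) : Prop :=
  heap s = heap S /\ forall y, y < m -> reg s y = reg S y.

Definition evaluated (d v : nat) (s s' : state) : Prop :=
  [/\ heap s' = heap s, forall y, y < d -> reg s' y = reg s y & reg s' d = v].

Definition executed (m d : nat) (S s s' : state) : Prop :=
  agree m s' S /\ forall y, m <= y < d -> reg s' y = reg s y.

Lemma evaluated_agree m d v s s' S :
  m <= d -> agree m s S -> evaluated d v s s' -> agree m s' S.
Proof.
move=> lemd [hS rS] [h1 h2 _]; split=> [|y lty]; first by rewrite h1.
by rewrite h2 ?rS // (leq_trans lty).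
Qed.

Section Compile.
Variables n m : nat.
Hypothesis m0 : 0 < m.

Lemma run_pair e1 e2 d s S :
  m <= d -> agree m s S -> reg S 0 = n ->
  (forall d s, m <= d -> agree m s S ->
     run (comp_expr d e1) s (cost_expr n e1) (evaluated d (eval n e1 S) s)) ->
  (forall d s, m <= d -> agree m s S ->
     run (comp_expr d e2) s (cost_expr n e2) (evaluated d (eval n e2 S) s)) ->
  forall c Q,
  (forall s', [/\ heap s' = heap s, forall y, y < d -> reg s' y = reg s y,
     reg s' d = eval n e1 S & reg s' d.+1 = eval n e2 S] -> run c s' 1 Q) ->
  run (Seq (comp_expr d e1) (Seq (comp_expr d.+1 e2) c)) s
    (cost_expr n e1 + (cost_expr n e2 + 1)) Q.
Proof.
move=> lemd sS S0 run1 run2 c Q runc.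
apply: run_seq (run1 _ _ lemd sS) _ => s1 ev1.
apply: run_seq (run2 _ _ (leqW lemd) (evaluated_agree lemd sS ev1)) _ => s2.
case: ev1 => [h1 h2 h3] [k1 k2 k3]; apply: runc; split=> //.
- by rewrite k1.
- by move=> y lty; rewrite k2 ?h2 // ltnW.
- by rewrite k2.
Qed.

Lemma run_expr e d s S :
  wf_expr m e -> m <= d -> agree m s S -> reg S 0 = n ->
  run (comp_expr d e) s (cost_expr n e) (evaluated d (eval n e S) s).
Proof.
elim: e d s S => [k|x|e IH|e1 IH1 e2 IH2|e1 IH1 e2 IH2|x e IH] d s S /=
  wf lemd sS S0; have [hS rS] := sS.
- apply: run_last; first exact: exec_Const.
  by split=> [|y lty|] //=; registers.
- apply: run_step; first exact: exec_Const.
  apply: run_last; first exact: exec_Add.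
  have ltxd : x < d by apply: leq_trans lemd.
  split=> [|y lty|] //=; registers => //.
  by rewrite addn0 rS.
- apply: run_seq (IH _ _ _ wf lemd sS S0) _ => s' [h1 h2 h3].
  apply: run_last; first exact: exec_Read.
  split=> [|y lty|] //; registers; first exact: h2.
  by rewrite h1 h3 hS.
- case/andP: wf => wf1 wf2; apply: (run_pair lemd sS S0) => [*|*|s' [h1 h2 h3 h4]].
  + exact: IH1.
  + exact: IH2.
  apply: run_last; first exact: exec_Add.
  by split=> [|y lty|] //; registers; rewrite ?h3 ?h4 ?h2.
- case/andP: wf => wf1 wf2; apply: (run_pair lemd sS S0) => [*|*|s' [h1 h2 h3 h4]].
  + exact: IH1.
  + exact: IH2.
  apply: run_last; first exact: exec_Sub.
  by split=> [|y lty|] //; registers; rewrite ?h3 ?h4 ?h2.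
case/andP: wf => /andP[x0 ltxm] wf.
have ltxd : x < d by apply: leq_trans lemd.
apply: run_step; first exact: exec_Const.
apply: run_step; first exact: exec_Add.
pose J i s' := [/\ heap s' = heap s,
  forall y, y < d -> y != x -> reg s' y = reg s y,
  reg s' d = \sum_(j < i) eval n e (set_reg S x j) & reg s' d.+1 = reg s x].
apply: (run_seq (R := J n)) => [|s1 [J1 J2 J3 J4]]; last first.
  apply: run_step; first exact: exec_Const.
  apply: run_last; first exact: exec_Add.
  split=> [//|y lty|] /=; last by registers.
  rewrite !updateE; case: eqP => [->|/eqP yx].
    by registers; rewrite J4 addn0.
  by registers; rewrite J2 //; lia.
apply: (run_loop (Q := J)) => //; first by lia.
- by move=> i s' [_ J2 _ _]; rewrite J2 ?rS //; lia.
- move=> i s' y v ley [J1 J2 J3 J4]; split=> //=.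
  + by move=> z ltz zx; registers; rewrite J2.
  + by registers.
  + by registers.
- move=> i s' lti [J1 J2 J3 J4].
  have sS' : agree m (set_reg s' x i) (set_reg S x i).
    split=> [|y lty] /=; first by rewrite J1.
    rewrite !updateE; case: eqP => // /eqP yx.
    by rewrite J2 ?rS //; apply: leq_trans lemd.
  have S'0 : reg (set_reg S x i) 0 = n by registers.
  have run_e := IH d.+3 _ _ wf (leqW (leqW (leqW lemd))) sS' S'0.
  apply: run_seq run_e _ => s1 [k1 k2 k3].
  apply: run_last; first exact: exec_Add.
  split; last by registers; rewrite k2 //; registers.
  split=> /=.
  + by rewrite k1.
  + move=> y lty yx; registers; rewrite k2; last by lia.
    by rewrite /= updateE (negPf yx) J2.
  + rewrite updateE eqxx k3 k2; last by lia.
    by registers; rewrite J3 big_ord_recr.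
  + registers; rewrite k2; last by lia.
    by registers.
split=> //=.
- by move=> y lty yx; registers.
- by registers; rewrite big_ord0.
- by registers; rewrite addn0.
Qed.

Lemma den_reg0 c S : wf_stmt m c -> reg (den n c S) 0 = reg S 0.
Proof.
elim: c S => [x e|a e|c1 IH1 c2 IH2|e c IH|x c IH] S //=.
- by case/andP=> /andP[x0 _] _; rewrite updateE ltn_eqF.
- by case/andP=> w1 w2; rewrite IH2 ?IH1.
- by case/andP=> _ w; case: ifP => // _; exact: IH.
case/andP=> /andP[x0 _] w; elim: (iota 0 n) S => //= i r IHr S.
by rewrite IHr IH //= updateE ltn_eqF.
Qed.

Lemma run_stmt c d s S :
  wf_stmt m c -> m <= d -> agree m s S -> reg S 0 = n ->
  run (comp_stmt d c) s (cost_stmt n c) (executed m d (den n c S) s).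
Proof.
elim: c d s S => [x e|a e|c1 IH1 c2 IH2|e c IH|x c IH] d s S /=
  wf lemd sS S0; have [hS rS] := sS.
- case/andP: wf => /andP[x0 ltxm] wf.
  apply: run_seq (run_expr wf lemd sS S0) _ => s1 [h1 h2 h3].
  apply: run_step; first exact: exec_Const.
  apply: run_last; first exact: exec_Add.
  split=> [|y /andP[ley lty]] /=; last by registers; rewrite h2.
  split=> [|y lty] /=; first by rewrite h1.
  rewrite !updateE; case: eqP => [_|/eqP yx].
    by registers; rewrite h3 addn0.
  by registers; rewrite h2 ?rS //; lia.
- case/andP: wf => wf1 wf2; apply: (run_pair lemd sS S0) => [*|*|s' [h1 h2 h3 h4]].
  + exact: run_expr.
  + exact: run_expr.
  apply: run_last; first exact: exec_Write.
  split=> [|y /andP[ley lty]] /=; last by rewrite h2.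
  split=> [|y lty] /=; first by rewrite h3 h4 h1 hS.
  by rewrite h2 ?rS // (leq_trans lty).
- case/andP: wf => wf1 wf2.
  apply: run_seq (IH1 d _ _ wf1 lemd sS S0) _ => s1 [h1 h2].
  have S'0 : reg (den n c1 S) 0 = n by rewrite den_reg0.
  apply: run_weaken (IH2 d _ _ wf2 lemd h1 S'0) _ _ => // s2 [k1 k2].
  by split=> // y hy; rewrite k2 ?h2.
- case/andP: wf => wf1 wf2.
  apply: run_seq (run_expr wf1 lemd sS S0) _ => s1 ev.
  have s1S := evaluated_agree lemd sS ev; case: ev => h1 h2 h3.
  case: ifP => [/eqP e0|/negbT e0].
    exists 2, s1; split; [|by lia|].
    + by apply: exec_IfF; [rewrite h3 | apply: exec_Skip].
    + by split=> // y /andP[_ lty]; rewrite h2.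
  have [t [s2 [e2 le2 [k1 k2]]]] := IH d s1 S wf2 lemd s1S S0.
  exists t.+1, s2; split; [|by lia|].
    by apply: exec_IfT => //; rewrite h3.
  by split=> // y hy; rewrite k2 // h2 //; case/andP: hy.
case/andP: wf => /andP[x0 ltxm] wf.
have ltxd : x < d by apply: leq_trans lemd.
pose f (s : state) i := den n c (set_reg s x i).
pose J i s' := executed m d (foldl f S (iota 0 i)) s s'.
have f0 i : reg (foldl f S (iota 0 i)) 0 = n.
  elim: (iota 0 i) S S0 {sS rS hS J} => //= j r IHr S0 S00.
  by apply: IHr; rewrite /f den_reg0 //; registers.
apply: (run_loop (Q := J)) => //.
- by move=> i s' [[_ ->]].
- move=> i s' y v ley [[J1 J2] J3]; split; first split=> //=.
  + by move=> z ltz; registers; rewrite J2.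
  + by move=> z /andP[lez ltz] /=; registers; rewrite J3 ?lez.
- move=> i s' lti [[J1 J2] J3].
  have sS' : agree m (set_reg s' x i) (set_reg (foldl f S (iota 0 i)) x i).
    by split=> [|y lty] //=; rewrite !updateE; case: eqP => // _; apply: J2.
  have S'0 : reg (set_reg (foldl f S (iota 0 i)) x i) 0 = n.
    by registers; rewrite f0.
  apply: run_weaken (IH d.+1 _ _ wf (leqW lemd) sS' S'0) _ _ => // s1 [k1 k2].
  split; first split.
  + by rewrite -addn1 iotaD foldl_cat.
  + move=> y /andP[ley lty]; rewrite k2 ?ley /=; last by lia.
    by registers; rewrite J3 ?ley.
  + by rewrite k2 ?lemd //; registers.
Qed.

End Compile.

(** With [n.+1] instead of [n] the bounds stay monotone in the exponent at
    [n = 0], which makes them closed under sums. *)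
Definition poly_bounded (f : nat -> nat) : Prop :=
  exists a k, forall n, f n <= a * n.+1 ^ k.

Lemma poly_const c : poly_bounded (fun=> c).
Proof. by exists c, 0 => n; rewrite muln1. Qed.

Lemma poly_add f g :
  poly_bounded f -> poly_bounded g -> poly_bounded (fun n => f n + g n).
Proof.
move=> [a [k fa]] [b [l gb]]; exists (a + b), (k + l) => n.
rewrite mulnDl leq_add //.
  by apply: leq_trans (fa n) _; rewrite leq_mul2l leq_pexp2l ?leq_addr ?orbT.
by apply: leq_trans (gb n) _; rewrite leq_mul2l leq_pexp2l ?leq_addl ?orbT.
Qed.

Lemma poly_muln f : poly_bounded f -> poly_bounded (fun n => n * f n).
Proof.
move=> [a [k fa]]; exists a, k.+1 => n.
by rewrite expnS mulnCA leq_mul.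
Qed.

Lemma poly_loop f : poly_bounded f -> poly_bounded (fun n => loop_cost n (f n)).
Proof.
move=> pf; apply: poly_add (poly_const _).
by apply/poly_muln/poly_add; last exact: poly_const.
Qed.

Lemma poly_cost_expr e : poly_bounded (cost_expr ^~ e).
Proof.
elim: e => [k|x|e IH|e1 IH1 e2 IH2|e1 IH1 e2 IH2|x e IH] /=.
- exact: poly_const.
- exact: poly_const.
- exact: poly_add IH (poly_const 1).
- exact: poly_add IH1 (poly_add IH2 (poly_const 1)).
- exact: poly_add IH1 (poly_add IH2 (poly_const 1)).
have [a [k h]] :=
  poly_add (poly_loop (poly_add IH (poly_const 1))) (poly_const 4).
by exists a, k => n; apply: leq_trans (h n); rewrite !addnS.
Qed.

Lemma poly_cost_stmt c : poly_bounded (cost_stmt ^~ c).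
Proof.
elim: c => [x e|a e|c1 IH1 c2 IH2|e c IH|x c IH] /=.
- exact: poly_add (poly_cost_expr e) (poly_const 2).
- exact: poly_add (poly_cost_expr a) (poly_add (poly_cost_expr e) (poly_const 1)).
- exact: poly_add IH1 IH2.
- exact: poly_add (poly_cost_expr e) (poly_add IH (poly_const 2)).
- exact: poly_loop.
Qed.

(** A loop program with result in register 1, where 0 stands for the absence of
    an answer, solves the problem in polynomial time as soon as its denotation
    is right; no reasoning about running time is left. *)
Theorem loop_program_solves class answer m c :
  1 < m -> wf_stmt m c ->
  (forall n (G : sgraph 'I_n), class n G ->
     let best := reg (den n c (graph_input G)) 1 in
     answer n G (if best == 0 then None else Some best)) ->
  solvable_in_polynomial_time class answer.
Proof.
move=> m1 wf ok.
have [a [k costP]] := poly_cost_stmt (Then c (Assign 1 (Num 0))).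
(* The last two instructions copy register 1 to register 0. *)
exists (Seq (comp_stmt m c) (Seq (Const m 0) (Add 0 1 m))), (a * 2 ^ k), k.
move=> n G /ok {ok}; set S := den n c _ => /= ans.
have [||||t1 [s1 [e1 le1 [[_ r1] _]]]] :=
  @run_stmt n m (ltnW m1) c m (graph_input G) (graph_input G) => //.
pose s2 := set_reg (set_reg s1 m 0) 0 (reg s1 1).
exists (t1 + (1 + 1)), s2; split.
- apply: exec_Seq e1 (exec_Seq (exec_Const _ _ _) _).
  have -> : s2 = set_reg (set_reg s1 m 0) 0
    (reg (set_reg s1 m 0) 1 + reg (set_reg s1 m 0) m).
    by rewrite /s2; congr (set_reg _ _ _); registers; rewrite addn0.
  exact: exec_Add.
- have le2 : t1 + 2 <= a * n.+1 ^ k.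
    apply: leq_trans (costP n); rewrite /= leq_add // (leq_trans le1) //.
  apply: leq_trans le2 _; case: (posnP n) => [->|n0].
    by rewrite exp1n muln1 (leq_trans _ (leq_addl _ _)) // leq_pmulr // expn_gt0.
  apply: leq_trans (leq_addr _ _).
  rewrite -mulnA -expnMn leq_mul2l; apply/orP; right.
  by case: (k) => // l; rewrite leq_exp2r //; lia.
- by rewrite /output /s2; registers; rewrite (r1 1 m1 : _ = reg S 1).
Qed.

(** * Perfect matchings by auction *)

Section Auction.
Variables (T : finType) (R : rel T).
Implicit Types (p : T -> nat) (o : T -> option T).

Definition unmatched o x : bool := [forall r, o r != Some x].

(** The fourth clause is complementary slackness up to 1: an owner holds an
    almost cheapest neighbour. *)
Definition auction_inv p o : Prop :=
  [/\ forall r r' x, o r = Some x -> o r' = Some x -> r = r',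
      forall r x, o r = Some x -> R x r,
      forall r, o r = None -> p r = 0,
      forall r r' x, o r = Some x -> R x r' -> p r <= p r' + 1
    & forall r, p r <= #|T|].

Definition raise p r0 : T -> nat := fun r => p r + (r == r0).
Definition assign o r0 x : T -> option T := fun r => if r == r0 then Some x else o r.

Lemma card_others x : #|[pred y : T | y != x]| < #|T|.
Proof. by rewrite (cardC1 x) ltn_predL; apply/card_gt0P; exists x. Qed.

(** Distinct right vertices have distinct owners, none of which is [x]. *)
Lemma sum_over_owners p o (F : T -> nat) x :
  auction_inv p o -> unmatched o x ->
  \sum_(r | o r) (if o r is Some y then F y else 0) <= \sum_(y | y != x) F y.
Proof.
move=> [inj _ _ _ _] /forallP ux.
have -> : \sum_(r | o r) (if o r is Some y then F y else 0) =
  \sum_r \sum_(y | o r == Some y) F y.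
  rewrite big_mkcond; apply: eq_bigr => r _; case: (o r) => [y|] /=.
    by rewrite (big_pred1 y) // => z; rewrite eq_sym.
  by rewrite big_pred0.
rewrite (exchange_big_dep (fun y => y != x)) /=; last first.
  by move=> r y _ /eqP e; apply: contraTneq (ux r) => <-; rewrite e eqxx.
apply: leq_sum => y _; case: (pickP (fun r => o r == Some y)) => [r0 /eqP e|none].
  rewrite (big_pred1 r0) // => r; apply/eqP/eqP => [h|->//].
  exact: inj h e.
by rewrite big_pred0.
Qed.

Variable f : T -> T.
Hypothesis (f_inj : injective f) (Rf : forall x, R x (f x)).

(** Only owned vertices have a positive price, and the owner [y] of [r] satisfies
    [p r <= p (f y) + 1].  Summing over [r], the total price is at most the sum
    of [p (f y) + 1] over the matched [y].  As [f] is a bijection, the total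
    price is also the sum of all [p (f y)], so the terms of the unmatched
    vertices add up to at most the number of matched ones. *)
Lemma cheap_partner p o x :
  auction_inv p o -> unmatched o x -> p (f x) < #|T|.
Proof.
move=> inv ux; case: (inv) => _ _ free stable _.
have le : \sum_r p r <= \sum_(y | y != x) (p (f y) + 1).
  apply: leq_trans (sum_over_owners (fun y => p (f y) + 1) inv ux).
  rewrite [X in _ <= X]big_mkcond; apply: leq_sum => r _.
  case e: (o r) => [y|] /=; last by rewrite free.
  exact: stable e (Rf y).
have := le; rewrite (reindex_inj f_inj) (bigD1 x) //= big_split /= addnC leq_add2l.
by rewrite sum1_card => /leq_ltn_trans; apply; exact: card_others.
Qed.

(** Taking a cheapest neighbour preserves slackness for the bidder, and raising
    a price preserves it for the others; the bound on prices survives because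
    the cheapest neighbour costs at most as much as [f x]. *)
Lemma auction_step p o x r :
  auction_inv p o -> unmatched o x -> R x r ->
  (forall r', R x r' -> p r <= p r') ->
  auction_inv (raise p r) (assign o r x).
Proof.
move=> inv ux Rxr rmin; have cheap := cheap_partner inv ux.
case: inv => inj ok free stable bound; rewrite /raise /assign; split.
- move=> r1 r2 y; case: eqP => [->|_]; case: eqP => [->|_] //; last exact: inj.
  + by move=> [<-] e; have /forallP/(_ r2) := ux; rewrite e eqxx.
  + by move=> e [ex]; have /forallP/(_ r1) := ux; rewrite e ex eqxx.
- by move=> r1 y; case: eqP => [-> [<-]|_ /ok].
- by move=> r1; case: eqP => // _ /free ->.
- move=> r1 r2 y; case: eqP => [-> [<-] Rxr2|_ e Ryr2].
    by have := rmin _ Rxr2; lia.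
  by have := stable _ _ _ e Ryr2; lia.
- move=> r1; case: eqP => [->|_]; last by rewrite addn0.
  by have := rmin _ (Rf x); lia.
Qed.

Lemma sum_raise p r : \sum_i raise p r i = (\sum_i p i).+1.
Proof.
rewrite big_split /= -addn1; congr (_ + _).
by rewrite -big_mkcond /= sum1_card card1.
Qed.

(** While [x] is unmatched, some right vertex is free, hence has price 0, and the
    others cost at most [#|T|].  Since each bid adds 1 to the total price, this
    bounds the number of bids. *)
Lemma auction_total p o x :
  auction_inv p o -> unmatched o x -> \sum_r p r < #|T| * #|T|.
Proof.
move=> inv ux.
have [r0 free0] : exists r, o r == None.
  have le : \sum_(r | o r) 1 <= \sum_(y | y != x) 1.
    apply: leq_trans (sum_over_owners (fun=> 1) inv ux).
    by apply: leq_sum => r; case: (o r).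
  apply/existsP; apply: contraTT le => /existsPn none.
  rewrite -ltnNge !sum1_card; apply: leq_trans (card_others x) _.
  by apply/subset_leq_card/subsetP => r _; rewrite unfold_in; case: (o r) (none r).
case: inv => _ _ free _ bound.
have T0 : 0 < #|T| by apply/card_gt0P; exists x.
rewrite (bigD1 r0) //= free ?(eqP free0) // add0n.
apply: (@leq_ltn_trans (\sum_(r | r != r0) #|T|)).
  by apply: leq_sum => r _; apply: bound.
by rewrite sum_nat_const ltn_mul2r T0; exact: card_others.
Qed.

End Auction.

(** * Matching cuts around a vertex of eccentricity at most 2 *)

Lemma set2_inj (T : finType) (a b c d : T) :
  [set a; b] = [set c; d] -> (a = c /\ b = d) \/ (a = d /\ b = c).
Proof.
move=> e; have := set21 a b; have := set22 a b; rewrite e !inE.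
have := set21 c d; have := set22 c d; rewrite -e !inE.
by do 4!case/orP=> /eqP ?; subst; auto.
Qed.

Section Graph.
Variables (T : finType) (G : sgraph T).
Implicit Types (x y z v w : T) (A : {set T}) (M P : {set {set T}}).

Lemma in_edges x y : ([set x; y] \in edges G) = G x y.
Proof.
apply/imsetP/idP => [[[a b]]|Gxy]; last by exists (x, y); rewrite ?inE.
by rewrite inE /= => Gab /set2_inj[] [-> ->]; rewrite // adj_sym.
Qed.

Definition cut A x y : bool := G x y && (x \in A != (y \in A)).

Lemma cut_sym A x y : cut A x y = cut A y x.
Proof. by rewrite /cut adj_sym eq_sym. Qed.

Lemma in_cut_edges A x y : ([set x; y] \in cut_edges G A) = cut A x y.
Proof.
rewrite /cut; apply/imsetP/andP => [[[a b]]|[Gxy]].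
  rewrite inE /= => /and3P[Gab aA bA] /set2_inj[] [-> ->];
  by rewrite ?[G b a]adj_sym Gab aA (negPf bA).
case xA: (x \in A); case yA: (y \in A) => // _.
  by exists (x, y); rewrite // inE /= Gxy xA yA.
by exists (y, x); rewrite ?inE /= 1?adj_sym ?Gxy ?yA ?xA // setUC.
Qed.

Lemma cut_edges_sub A B :
  (forall x y, cut A x y -> cut B x y) -> cut_edges G A \subset cut_edges G B.
Proof.
move=> AB; apply/subsetP => X /imsetP[[x y]]; rewrite inE /= => /and3P[Gxy xA yA] ->.
by rewrite in_cut_edges AB // /cut Gxy xA (negPf yA).
Qed.

Lemma cut_edgesC A : cut_edges G (~: A) = cut_edges G A.
Proof.
apply/eqP; rewrite eqEsubset; apply/andP; split; apply: cut_edges_sub => x y;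
by rewrite /cut !inE; case: (x \in A); case: (y \in A).
Qed.

Lemma card_cut_edges A :
  #|cut_edges G A| = \sum_x \sum_y ([&& G x y, x \in A & y \notin A] : nat).
Proof.
rewrite card_in_imset; last first.
  move=> [a b] [c d]; rewrite !inE /= => /and3P[_ aA bA] /and3P[_ cA dA].
  by case/set2_inj => -[e1 e2]; [rewrite e1 e2 | move: bA; rewrite e2 cA].
rewrite pair_big /= -sum1_card big_mkcond /=; apply: eq_bigr => p _.
by rewrite inE; case: ifP.
Qed.

Lemma matching_unique M x y z :
  matching G M -> [set x; y] \in M -> [set x; z] \in M -> y = z.
Proof.
case/andP=> /subsetP ME /trivIsetP tM Mxy Mxz.
case: (eqVneq [set x; y] [set x; z]) => [|ne].
  by case/set2_inj => -[] // -> ->.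
have /pred0P/(_ x) := tM _ _ Mxy Mxz ne.
by rewrite /= !inE eqxx.
Qed.

Lemma perfect_partner P x :
  perfect_matching G P -> exists2 y, G x y & [set x; y] \in P.
Proof.
case/andP=> /andP[/subsetP PE _] /eqP cP.
have : x \in cover P by rewrite cP.
case/bigcupP => X XP; have /imsetP[[a b]] := PE _ XP.
rewrite inE /= => Gab eX; rewrite eX in XP *; rewrite !inE => /orP[] /eqP->.
  by exists b.
by exists a; rewrite 1?adj_sym // setUC.
Qed.

(** The relation is not symmetric: it forces the partner of [x], but not that of
    [y].  A map that is total meets the constraint at every vertex anyway. *)
Definition allowed A x y : bool :=
  G x y && [forall z, cut A x z ==> (z == y)].

(** An injective map along allowed edges is a perfect matching of the bipartite
    double cover. *)
Definition extendable A : bool :=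
  [exists f : {ffun T -> T}, injectiveb f && [forall x, allowed A x (f x)]].

Lemma extendableP A :
  reflect (exists2 f : T -> T, injective f & forall x, allowed A x (f x))
    (extendable A).
Proof.
apply: (iffP existsP) => [[f /andP[/injectiveP fi /forallP fa]]|[f fi fa]].
  by exists f.
exists (finfun f); apply/andP; split.
  by apply/injectiveP => x y; rewrite !ffunE; exact: fi.
by apply/forallP => x; rewrite ffunE.
Qed.

Lemma extendable_of_matching A P :
  perfect_matching G P -> cut_edges G A \subset P -> extendable A.
Proof.
move=> pP /subsetP AP; have mP : matching G P by case/andP: pP.
have /fin_all_exists2[f Gf Pf] x := perfect_partner x pP.
apply/extendableP; exists f => [x y e|x].
  apply: (matching_unique mP (x := f x)); first by rewrite setUC; apply: Pf.
  by rewrite e setUC; apply: Pf.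
rewrite /allowed Gf; apply/forallP => z; apply/implyP => cxz; apply/eqP.
by apply: matching_unique mP _ (Pf x); apply: AP; rewrite in_cut_edges.
Qed.

(** With [S] one side of the bipartition, [f] maps [S] into its complement and
    conversely; by injectivity both sides have the same size, so the edges
    [x -- f x] with [x] in [S] cover everything.  A cut edge has an endpoint [x]
    in [S], where it is forced to be the edge chosen by [f]. *)
Lemma matching_of_extendable A :
  bipartite G -> extendable A ->
  exists2 P, perfect_matching G P & cut_edges G A \subset P.
Proof.
move=> [S GS] /extendableP[f f_inj fA].
have Gf x : G x (f x) by case/andP: (fA x).
have fS x : (f x \in S) = (x \notin S).
  by have := GS _ _ (Gf x); case: (x \in S); case: (f x \in S).
have imS : f @: S = ~: S.
  have sub1 : f @: S \subset ~: S.
    by apply/subsetP => _ /imsetP[x xS ->]; rewrite inE fS xS.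
  have sub2 : f @: (~: S) \subset S.
    by apply/subsetP => _ /imsetP[x xS ->]; rewrite fS -in_setC.
  apply/eqP; rewrite eqEcard sub1 card_imset //.
  by have := subset_leq_card sub2; rewrite card_imset.
pose P := [set [set x; f x] | x in S].
exists P.
  apply/andP; split; first (apply/andP; split).
  - by apply/subsetP => _ /imsetP[x xS ->]; rewrite in_edges.
  - apply/trivIsetP => _ _ /imsetP[x xS ->] /imsetP[y yS ->] ne.
    have xy : x != y by apply: contraNneq ne => ->.
    rewrite disjoints_subset; apply/subsetP => z; rewrite !inE => /orP[] /eqP->.
      rewrite negb_or xy; apply: contraTneq xS => ->.
      by rewrite fS negbK.
    rewrite negb_or (inj_eq f_inj) xy andbT; apply: contraTneq yS => <-.
    by rewrite fS negbK.
  - apply/eqP/setP => y; rewrite inE; apply/bigcupP.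
    case yS: (y \in S).
      by exists [set y; f y]; [apply: imset_f | rewrite !inE eqxx].
    have /imsetP[x xS ey] : y \in f @: S by rewrite imS inE yS.
    by exists [set x; f x]; [apply: imset_f | rewrite ey !inE eqxx orbT].
have main x y : x \in S -> cut A x y -> [set x; y] \in P.
  move=> xS cxy; have /andP[_ /forallP/(_ y)] := fA x.
  by rewrite cxy /= => /eqP ->; apply: imset_f.
apply/subsetP => X XA; have /imsetP[[x y]] := XA; rewrite inE /= => /andP[Gxy _] eX.
rewrite eX in_cut_edges in XA; rewrite eX.
have := GS _ _ Gxy; case: (boolP (x \in S)) => [xS _|_ yS]; first exact: main.
by rewrite setUC; apply: main; [case: (y \in S) yS | rewrite cut_sym].
Qed.

Lemma extendable_matching_cut A :
  bipartite G -> extendable A -> 0 < #|cut_edges G A| ->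
  disconnected_perfect_matching G (cut_edges G A).
Proof.
move=> bG eA /card_gt0P[X XA].
have [P pP AP] := matching_of_extendable bG eA.
have /andP[/andP[PE tP] _] := pP.
apply/andP; split; last by apply/existsP; exists P; rewrite pP.
apply/andP; split.
  by rewrite /matching (subset_trans AP PE) (trivIsetS AP tP).
have /imsetP[[x y]] := XA; rewrite inE /= => /and3P[Gxy xA yA] _.
apply/existsP; exists A; rewrite eqxx andbT; apply/andP; split.
  by apply/set0Pn; exists x.
by apply/set0Pn; exists y; rewrite inE.
Qed.

Definition degree x : nat := \sum_y (G x y : nat).

Definition leaf x : bool := degree x <= 1.

(** Non-adjacent pairs, such as [v = w], stand for the cuts that separate [v] from
    none of its neighbours. *)
Definition candidate v w : {set T} :=
  [set x | (x != v) &&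
    ((G v w && ((x == w) || G w x)) || (leaf x && ~~ G v x))].

Lemma leaf_neighbour_unique x y z : leaf x -> G x y -> G x z -> y = z.
Proof.
rewrite /leaf /degree => le Gxy Gxz; apply/eqP; apply: contraTT le => ne.
by rewrite (bigD1 y) //= (bigD1 z) 1?eq_sym //= Gxy Gxz.
Qed.

Lemma leaf_intro x : (forall y z, G x y -> G x z -> y = z) -> leaf x.
Proof.
move=> uniq; rewrite /leaf /degree; case: (pickP (G x)) => [y Gxy|none].
  rewrite (bigD1 y) //= Gxy big1 // => z /negPf zy.
  by case e: (G x z) => //; rewrite (uniq _ _ Gxy e) eqxx in zy.
by rewrite big1 // => y _; rewrite none.
Qed.

(** A vertex on the side opposite to [v] is at odd distance at most 2. *)
Lemma center_neighbours (S : {set T}) v :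
  (forall x y, G x y -> (x \in S) != (y \in S)) ->
  (forall u, exists2 d, is_dist G v u d & d <= 2) ->
  forall x, G v x = (x \in S != (v \in S)).
Proof.
move=> GS rad x; apply/idP/idP => [/GS|]; first by rewrite eq_sym.
have [d [[p /and3P[vp /eqP lp _] sp] _] d2] := rad x.
case: p vp lp sp => [|a [|b [|? ?]]] /=.
- by move=> _ ->; rewrite eqxx.
- by rewrite andbT => Ga <-.
- rewrite andbT => /andP[Gva Gab] <- _.
  have := GS _ _ Gva; have := GS _ _ Gab.
  by case: (v \in S); case: (a \in S); case: (b \in S).
- by move=> _ _ sd; rewrite -sd in d2.
Qed.

Lemma has_neighbour v x :
  (forall u, exists2 d, is_dist G v u d & d <= 2) ->
  x != v -> exists y, G x y.
Proof.
move=> rad; have [d [[p /and3P[vp /eqP lp _] sp] _] _] := rad x.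
case/lastP: p vp lp {sp} => [|p y] /=; first by move=> _ ->; rewrite eqxx.
rewrite rcons_path last_rcons => /andP[_ G1] <- _.
by exists (last v p); rewrite adj_sym.
Qed.

Section Center.
Variables (S : {set T}) (v : T).
Hypothesis GS : forall x y, G x y -> (x \in S) != (y \in S).
Hypothesis rad : forall u, exists2 d, is_dist G v u d & d <= 2.

Variables (A : {set T}) (P : {set {set T}}).
Hypothesis (vA : v \notin A) (pP : perfect_matching G P).
Hypothesis AP : cut_edges G A \subset P.

Lemma cut_unique x y z : cut A x y -> cut A x z -> y = z.
Proof.
rewrite -!in_cut_edges => cxy cxz; have mP : matching G P by case/andP: pP.
by apply: (matching_unique mP (x := x)); apply: (subsetP AP).
Qed.

(** Replacing [A] by a candidate only adds leaf edges to the cut, and those lie in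
    every perfect matching. *)
Lemma candidate_extends_cut : A != set0 ->
  exists w, [/\ cut_edges G A \subset cut_edges G (candidate v w),
    cut_edges G (candidate v w) \subset P & 0 < #|cut_edges G A|].
Proof.
move=> /set0Pn[a aA].
have nbr := center_neighbours GS rad.
have other x y : G x y -> G v x = ~~ G v y.
  by move=> Gxy; rewrite !nbr; have := GS Gxy; do 3!case: (_ \in S).
have leaf_edge x y : leaf x -> G x y -> [set x; y] \in P.
  move=> lx Gxy; have [z Gxz] := perfect_partner x pP.
  by rewrite (leaf_neighbour_unique lx Gxy Gxz).
have vA_cut z : G v z -> z \in A -> cut A v z.
  by move=> Gvz zA; rewrite /cut Gvz (negPf vA) zA.
have A_cut x y : G x y -> x \in A -> y \notin A -> cut A x y.
  by move=> Gxy xA yA; rewrite /cut Gxy xA (negPf yA).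
have sub w : (forall x y, G x y -> x \in A -> y \notin A ->
    x \in candidate v w /\ y \notin candidate v w) ->
  cut_edges G A \subset cut_edges G (candidate v w).
  move=> h; apply/subsetP => X /imsetP[[x y]].
  rewrite inE /= => /and3P[Gxy xA yA] ->; have [xB yB] := h _ _ Gxy xA yA.
  by rewrite in_cut_edges /cut Gxy xB (negPf yB).
have sup w : (forall x y, G x y -> x \in candidate v w ->
    y \notin candidate v w -> [set x; y] \in P) ->
  cut_edges G (candidate v w) \subset P.
  move=> h; apply/subsetP => X /imsetP[[x y]].
  by rewrite inE /= => /and3P[Gxy xA yA] ->; apply: h.
have cutP x y : cut A x y -> [set x; y] \in P.
  by rewrite -in_cut_edges => /(subsetP AP).
have leaf_A x : x \in A -> (forall y, G x y -> y \notin A) -> leaf x.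
  move=> xA out; apply: leaf_intro => y z Gxy Gxz.
  by apply: (@cut_unique x); apply: A_cut => //; apply: out.
case: (pickP (cut A v)) => [w cvw|none]; last first.
  (* No neighbour of [v] lies in [A], and [A] consists of leaves. *)
  have Gv z : G v z -> z \notin A.
    by move=> Gvz; apply: contraFN (none z); apply: vA_cut.
  have far x : x \in A -> x != v /\ ~~ G v x.
    move=> xA; split; first by apply: contraNneq vA => <-.
    by apply: contraTN xA; apply: Gv.
  have out x y : x \in A -> G x y -> G v y.
    by move=> /far[_ nx] Gxy; rewrite -[G v y]negbK -(other _ _ Gxy).
  exists v; split.
  - apply: sub => x y Gxy xA yA; have [xv nx] := far _ xA.
    rewrite !inE xv nx adj_irr /= (out _ _ xA Gxy) !andbF andbT; split=> //.
    by apply: leaf_A => // z Gxz; apply: Gv; apply: out Gxz.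
  - apply: sup => x y Gxy; rewrite !inE adj_irr /= => /and3P[_ lx _] _.
    exact: leaf_edge.
  - have [av _] := far _ aA; have [b Gab] := has_neighbour rad av.
    apply/card_gt0P; exists [set a; b]; rewrite in_cut_edges; apply: A_cut => //.
    by apply: Gv; apply: out Gab.
have Gvw : G v w by case/andP: cvw.
have wA : w \in A by case/andP: cvw => _; rewrite (negPf vA); case: (w \in A).
have uniq z : G v z -> z \in A -> z = w.
  by move=> Gvz zA; apply: cut_unique cvw; apply: vA_cut.
have wv : w != v by apply: contraTneq Gvw => ->; rewrite adj_irr.
have cwv : cut A w v by rewrite cut_sym.
have w_in z : G w z -> z != v -> z \in A.
  move=> Gwz; apply: contraNT => zA.
  by rewrite (@cut_unique w z v) //; apply: A_cut.
have inB x : (x \in candidate v w) =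
    (x != v) && ((x == w) || G w x || (leaf x && ~~ G v x)).
  by rewrite inE Gvw.
exists w; split.
(* A vertex of [A] outside [N(v)] is a neighbour of [w] or a leaf. *)
- apply: sub => x y Gxy xA yA; rewrite !inB.
  have xv : x != v by apply: contraNneq vA => <-.
  have yw : y != w by apply: contraNneq yA => ->.
  rewrite xv (negPf yw) /=; case Gvx: (G v x).
    have exw := uniq _ Gvx xA; rewrite exw eqxx; split=> //.
    rewrite exw in Gxy; rewrite Gxy /=.
    by rewrite negb_and negbK; case: eqP => // /eqP yv; rewrite (w_in y) in yA.
  have Gvy : G v y by rewrite -[G v y]negbK -(other _ _ Gxy) Gvx.
  have nGwy : G w y = false.
    by apply/negP => /other; rewrite Gvw Gvy.
  rewrite nGwy Gvy !andbF; split=> //.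
  case Gwx: (G w x); rewrite ?orbT // !orbF andbT; apply/orP; right.
  apply: leaf_A => // z Gxz; apply/negP => zA.
  have Gvz : G v z by rewrite -[G v z]negbK -(other _ _ Gxz) Gvx.
  by rewrite (uniq _ Gvz zA) adj_sym Gwx in Gxz.
(* An edge leaving the candidate is [w v], or joins a neighbour of [w], which is
   in [A], to a vertex of [N(v)] other than [w], or ends in a leaf. *)
- apply: sup => x y Gxy; rewrite !inB => /andP[xv].
  case/orP=> [/orP[/eqP ex|Gwx]|/andP[lx _]];
    last by move=> _; apply: leaf_edge.
    rewrite ex in Gxy *; rewrite Gxy orbT /= andbT negbK => /eqP ->.
    exact: cutP.
  have nGvx : G v x = false by have := other _ _ Gwx; rewrite Gvw; case: (G v x).
  have Gvy : G v y by rewrite -[G v y]negbK -(other _ _ Gxy) nGvx.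
  have yv : y != v by apply: contraTneq Gvy => ->; rewrite adj_irr.
  rewrite yv /= => /norP[/norP[yw _] _]; apply: cutP; apply: A_cut => //.
    exact: w_in.
  by apply: contraNN yw => yA; apply/eqP; apply: uniq.
- by apply/card_gt0P; exists [set w; v]; rewrite in_cut_edges.
Qed.
End Center.

Definition value (v w : T) : nat :=
  if extendable (candidate v w) then #|cut_edges G (candidate v w)| else 0.

(** By connectedness a cut is never empty, so the value 0 can stand for the
    absence of a disconnected perfect matching. *)
Lemma max_value best :
  bipartite G -> radius_at_most G 2 ->
  (forall v w, value v w <= best) ->
  best = 0 \/ (exists v w, best = value v w) ->
  max_disconnected_perfect_matching G (if best == 0 then None else Some best).
Proof.
move=> bG [v rad] ub attained.
have upper M : disconnected_perfect_matching G M -> 0 < #|M| <= best.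
  case/andP=> /andP[_ /existsP[A0 /and3P[A00 A01 /eqP eM]]].
  case/existsP=> P /andP[pP MP].
  have [A [vA A0' eA]] : exists A, [/\ v \notin A, A != set0 & M = cut_edges G A].
    case vA0: (v \in A0); last by exists A0; rewrite vA0.
    by exists (~: A0); rewrite inE vA0 cut_edgesC.
  rewrite eA in MP *; case: bG => S GS.
  have [w [sub sup ->]] := candidate_extends_cut GS rad vA pP MP A0'.
  apply: leq_trans (ub v w); rewrite /value (extendable_of_matching pP sup).
  exact: subset_leq_card.
case: eqP => [b0 M|/eqP b0].
  by apply/negP => /upper; rewrite b0; case: #|M|.
case: attained => [b0'|[v' [w' e]]]; first by rewrite b0' in b0.
split=> [|M /upper/andP[]//]; move: e b0; rewrite /value; case: ifP => [ex ->|_ -> //].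
rewrite -lt0n => c0; exists (cut_edges G (candidate v' w')); last by [].
exact: extendable_matching_cut.
Qed.
End Graph.

(** * The program and its correctness *)

(** Boolean expressions evaluate to 0 or 1. *)
Definition eNot e := Minus (Num 1) e.
Definition eAnd e1 e2 := Minus (Plus e1 e2) (Num 1).
Definition eOr e1 e2 := eNot (Minus (Num 1) (Plus e1 e2)).
Definition eLeq e1 e2 := eNot (Minus e1 e2).
Definition eEq e1 e2 := eAnd (eLeq e1 e2) (eLeq e2 e1).
Definition eAll x e := eNot (Sum x (eNot e)).
Definition eEx x e := eNot (eNot (Sum x e)).
(** The first [x] that satisfies [e], or [n] if there is none: the number of all
    [j] such that no [x <= j] satisfies [e]. *)
Definition eFirst j x e := Sum j (eNot (eEx x (eAnd (eLeq (Var x) (Var j)) e))).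

Lemma den_assign n x e s : den n (Assign x e) s = set_reg s x (eval n e s).
Proof. by []. Qed.

Lemma den_put n a e s :
  den n (Put a e) s = set_heap s (eval n a s) (eval n e s).
Proof. by []. Qed.

Lemma den_then n c1 c2 s : den n (Then c1 c2) s = den n c2 (den n c1 s).
Proof. by []. Qed.

Lemma den_when n e c s :
  den n (When e c) s = if eval n e s == 0 then s else den n c s.
Proof. by []. Qed.

Section Eval.
Variable n : nat.
Implicit Types (s : state) (e : expr).

Lemma eval_not e s (b : bool) : eval n e s = b -> eval n (eNot e) s = ~~ b.
Proof. by move=> /= ->; case: b. Qed.

Lemma eval_and e1 e2 s (b1 b2 : bool) :
  eval n e1 s = b1 -> eval n e2 s = b2 -> eval n (eAnd e1 e2) s = b1 && b2.
Proof. by move=> /= -> ->; case: b1; case: b2. Qed.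

Lemma eval_or e1 e2 s (b1 b2 : bool) :
  eval n e1 s = b1 -> eval n e2 s = b2 -> eval n (eOr e1 e2) s = b1 || b2.
Proof. by move=> /= -> ->; case: b1; case: b2. Qed.

Lemma eval_leq e1 e2 s a b :
  eval n e1 s = a -> eval n e2 s = b -> eval n (eLeq e1 e2) s = (a <= b).
Proof. by move=> /= -> ->; rewrite /leq; case: (a - b). Qed.

Lemma eval_eq e1 e2 s a b :
  eval n e1 s = a -> eval n e2 s = b -> eval n (eEq e1 e2) s = (a == b).
Proof.
by move=> h1 h2; rewrite eqn_leq; apply: eval_and; apply: eval_leq.
Qed.

Lemma eval_sum x e s (F : 'I_n -> nat) :
  (forall i : 'I_n, eval n e (set_reg s x i) = F i) ->
  eval n (Sum x e) s = \sum_i F i.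
Proof. by move=> h; apply: eq_bigr => i _. Qed.

Lemma eval_ex x e s (p : pred 'I_n) :
  (forall i : 'I_n, eval n e (set_reg s x i) = p i) ->
  eval n (eEx x e) s = [exists i, p i].
Proof.
move=> h; have := eval_sum h; rewrite /eEx /eNot /= => ->.
case: existsP => [[i pi]|none]; first by rewrite (bigD1 i) //= pi.
rewrite big1 // => i _; case pi: (p i) => //; case: none; by exists i.
Qed.

Lemma eval_all x e s (p : pred 'I_n) :
  (forall i : 'I_n, eval n e (set_reg s x i) = p i) ->
  eval n (eAll x e) s = [forall i, p i].
Proof.
move=> h.
have /eval_ex : forall i : 'I_n, eval n (eNot e) (set_reg s x i) = ~~ p i.
  by move=> i; apply: eval_not.
rewrite -negb_forall /eEx /eAll /eNot /=.
by case: [forall i, p i] => /=; lia.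
Qed.

Lemma eval_first j x e s (p : pred 'I_n) : j != x ->
  (forall a (i : 'I_n), eval n e (set_reg (set_reg s j a) x i) = p i) ->
  (exists2 i : 'I_n, p i & eval n (eFirst j x e) s = i) \/
  (forall i, ~~ p i) /\ eval n (eFirst j x e) s = n.
Proof.
move=> jx h.
have -> : eval n (eFirst j x e) s =
    \sum_(a < n) (~~ [exists i : 'I_n, (i <= a) && p i] : nat).
  apply: eval_sum => a; apply/eval_not/eval_ex => i; apply: eval_and => //.
  by apply: eval_leq; registers.
case: (pickP p) => [i0 pi0|none]; [left | right].
  case: (@arg_minnP _ i0 p val pi0) => i pi imin; exists i => //.
  rewrite -[RHS]card_ord -sum1_card (big_ord_widen n (fun=> 1)) 1?ltnW //.
  rewrite [RHS]big_mkcond; apply: eq_bigr => a _.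
  case: existsP => [[k /andP[ka pk]]|no] /=.
    by have ik : i <= k := imin _ pk; case: ifP => //; lia.
  case: ifP => // ia; case: no; exists i; rewrite pi andbT; lia.
split=> [i|]; first by rewrite none.
rewrite -[RHS]card_ord -sum1_card; apply: eq_bigr => a _.
by case: existsP => // -[i]; rewrite none andbF.
Qed.

(** Invariants are taken after [i] turns, so the body is entered with [i] already
    stored in [x]. *)
Lemma den_for x c s (I : nat -> state -> Prop) :
  I 0 s -> (forall (i : 'I_n) s, I i s -> I i.+1 (den n c (set_reg s x i))) ->
  I n (den n (For x c) s).
Proof.
move=> I0 step /=.
suff h k : k <= n -> I k (foldl (fun s i => den n c (set_reg s x i)) s (iota 0 k)).
  exact: h.
elim: k => [//|k IH] ltk; rewrite -addn1 iotaD foldl_cat addn1 /= add0n.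
exact: (step (Ordinal ltk)) (IH (ltnW ltk)).
Qed.

End Eval.

(** Register 1 holds the best value so far, registers 2 and 3 the pair [v], [w]
    that defines the candidate, 4 and 5 the left and right vertices [u] and [r]
    of a bid, 6 and 7 loop indices; the others are bound in expressions.  A
    product by [n] is a sum that ignores its index, here [x.+1], which differs
    from [x].  Prices and owners are stored after the adjacency matrix, at
    [n * n + r] and [n * n + n + r]; owner [u] is stored as [u + 1], and 0 means
    that [r] is free. *)
Definition Adj x y := Get (Plus (Sum x.+1 (Var x)) (Var y)).
Definition Leaf x := eLeq (Sum 15 (Adj x 15)) (Num 1).
Definition Candidate x :=
  eAnd (eNot (eEq (Var x) (Var 2)))
    (eOr (eAnd (Adj 2 3) (eOr (eEq (Var x) (Var 3)) (Adj 3 x)))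
         (eAnd (Leaf x) (eNot (Adj 2 x)))).
Definition Cut x y := eAnd (Adj x y) (eNot (eEq (Candidate x) (Candidate y))).
Definition Allowed x y :=
  eAnd (Adj x y) (eAll 14 (eOr (eNot (Cut x 14)) (eEq (Var 14) (Var y)))).
Definition CutSize :=
  Sum 12 (Sum 13 (eAnd (Adj 12 13) (eAnd (Candidate 12) (eNot (Candidate 13))))).

Definition PriceAt x := Plus (Sum x.+1 (Var 0)) (Var x).
Definition OwnerAt x := Plus (PriceAt x) (Var 0).
Definition Owns u r := eEq (Get (OwnerAt r)) (Plus (Var u) (Num 1)).
Definition Unmatched u := eAll 8 (eNot (Owns u 8)).
Definition Cheapest u r :=
  eAnd (Allowed u r)
    (eAll 8 (eOr (eNot (Allowed u 8)) (eLeq (Get (PriceAt r)) (Get (PriceAt 8))))).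

Definition Bid :=
  Then (Assign 4 (eFirst 9 4 (Unmatched 4)))
    (When (eNot (eLeq (Var 0) (Var 4)))
      (Then (Assign 5 (eFirst 9 5 (Cheapest 4 5)))
        (Then (Put (PriceAt 5) (Plus (Get (PriceAt 5)) (Num 1)))
          (Put (OwnerAt 5) (Plus (Var 4) (Num 1)))))).
Definition Reset :=
  For 5 (Then (Put (PriceAt 5) (Num 0)) (Put (OwnerAt 5) (Num 0))).
Definition Auction := For 6 (For 7 Bid).
Definition Check := eAll 4 (eEx 5 (eAnd (Owns 4 5) (Allowed 4 5))).
Definition TryCandidate :=
  Then Reset (Then Auction
    (When Check (Assign 1 (Plus (Var 1) (Minus CutSize (Var 1)))))).
Definition Program := For 2 (For 3 TryCandidate).

Lemma wf_Program : wf_stmt 17 Program.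
Proof. by []. Qed.

Section Program.
Variables (n : nat) (G : sgraph 'I_n).

Definition holds_input s : Prop :=
  reg s 0 = n /\ forall i j : 'I_n, heap s (i * n + j) = G i j.

Lemma matrix_address (i j : 'I_n) : i * n + j < n * n.
Proof. by have := ltn_ord i; have := ltn_ord j; nia. Qed.

Lemma eval_adj s x y (i j : 'I_n) :
  holds_input s -> reg s x = i -> reg s y = j -> eval n (Adj x y) s = G i j.
Proof.
case=> _ hG rx ry; rewrite /Adj.
have -> : eval n (Get (Plus (Sum x.+1 (Var x)) (Var y))) s =
  heap s (\sum_(k < n) i + j).
  rewrite /= ry; congr (heap s (_ + _)); apply: eq_bigr => k _.
  by registers.
by rewrite sum_nat_const card_ord mulnC hG.
Qed.

Variables v w : 'I_n.

Definition context s : Prop :=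
  [/\ holds_input s, reg s 2 = v & reg s 3 = w].

Lemma context_heap s a b : n * n <= a -> context s -> context (set_heap s a b).
Proof.
move=> lea [[r0 hG] r2 r3]; split=> //; split=> // i j.
by have lt := matrix_address i j; registers; rewrite hG.
Qed.

Lemma eval_leaf s x (i : 'I_n) :
  x < 15 -> holds_input s -> reg s x = i -> eval n (Leaf x) s = leaf G i.
Proof.
move=> ltx [r0 hG] rx; apply: eval_leq => //; apply: eval_sum => j.
by apply: eval_adj; [split=> //|..]; registers.
Qed.

Lemma eval_candidate s x (i : 'I_n) :
  x < 15 -> context s -> reg s x = i ->
  eval n (Candidate x) s = (i \in candidate G v w).
Proof.
move=> ltx [inp r2 r3] rx; rewrite inE; apply: eval_and.
  exact/eval_not/eval_eq.
apply: eval_or; apply: eval_and.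
- exact: eval_adj.
- by apply: eval_or; [apply: eval_eq | apply: eval_adj].
- exact: eval_leaf.
- exact/eval_not/eval_adj.
Qed.

Lemma eval_cut s x y (i j : 'I_n) :
  x < 15 -> y < 15 -> context s -> reg s x = i -> reg s y = j ->
  eval n (Cut x y) s = cut G (candidate G v w) i j.
Proof.
move=> ltx lty cs rx ry; apply: eval_and.
  by case: cs => inp _ _; apply: eval_adj.
apply: eval_not; rewrite (eval_eq (eval_candidate ltx cs rx) (eval_candidate lty cs ry)).
by case: (i \in _); case: (j \in _).
Qed.

Lemma eval_allowed s x y (i j : 'I_n) :
  x < 14 -> y < 14 -> context s -> reg s x = i -> reg s y = j ->
  eval n (Allowed x y) s = allowed G (candidate G v w) i j.
Proof.
move=> ltx lty cs rx ry; apply: eval_and.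
  by case: cs => inp _ _; apply: eval_adj.
apply: eval_all => k; rewrite implybE; apply: eval_or.
  apply: eval_not; apply: eval_cut => //; first exact: ltnW.
  by registers.
by apply: eval_eq; registers.
Qed.

Lemma eval_cut_size s :
  context s -> eval n CutSize s = #|cut_edges G (candidate G v w)|.
Proof.
move=> cs; rewrite card_cut_edges; apply: eval_sum => i; apply: eval_sum => j.
have cs' : context (set_reg (set_reg s 12 i) 13 j) by [].
apply: eval_and; first by case: cs' => inp _ _; apply: eval_adj.
by apply: eval_and; [|apply: eval_not]; apply: eval_candidate.
Qed.

Lemma eval_price_at s x : reg s 0 = n -> eval n (PriceAt x) s = n * n + reg s x.
Proof.
move=> r0 /=; congr (_ + _); under eq_bigr => i _ do registers.
by rewrite sum_nat_const card_ord r0.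
Qed.

Lemma eval_owner_at s x :
  reg s 0 = n -> eval n (OwnerAt x) s = n * n + reg s x + n.
Proof. by move=> r0; rewrite -(eval_price_at _ r0) /= r0. Qed.

Definition owner_code (o : option 'I_n) : nat := if o is Some u then u.+1 else 0.

Lemma owner_codeE o (u : 'I_n) : (owner_code o == u + 1) = (o == Some u).
Proof. by case: o => [z|] /=; rewrite addn1. Qed.

Definition stores (p : 'I_n -> nat) (o : 'I_n -> option 'I_n) s : Prop :=
  forall r : 'I_n,
    heap s (n * n + r) = p r /\ heap s (n * n + r + n) = owner_code (o r).

Lemma eval_owns s x y (i j : 'I_n) :
  reg s 0 = n -> reg s x = i -> reg s y = j ->
  eval n (Owns x y) s = (heap s (n * n + j + n) == i + 1).
Proof.
move=> r0 rx ry; apply: eval_eq; last by rewrite /= rx.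
by rewrite /eval -/eval eval_owner_at // ry.
Qed.

Lemma eval_check s : context s ->
  eval n Check s = [forall i : 'I_n, exists j : 'I_n,
    (heap s (n * n + j + n) == i + 1) && allowed G (candidate G v w) i j].
Proof.
move=> cs; apply: eval_all => i; apply: eval_ex => j.
have cs' : context (set_reg (set_reg s 4 i) 5 j) by [].
apply: eval_and; last exact: eval_allowed.
by apply: eval_owns => //; case: cs' => -[].
Qed.

Let B := candidate G v w.
Let R := allowed G B.

Definition phase best s : Prop := context s /\ reg s 1 = best.

Lemma eval_unmatched p o s x (i : 'I_n) :
  x < 8 -> reg s 0 = n -> stores p o s -> reg s x = i ->
  eval n (Unmatched x) s = unmatched o i.
Proof.
move=> ltx r0 st rx; apply: eval_all => r; apply: eval_not.
rewrite -(owner_codeE (o r)) -(st r).2.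
by apply: (@eval_owns (set_reg s 8 r)) => //; registers.
Qed.

Lemma eval_cheapest p o s x y (i j : 'I_n) :
  x < 8 -> y < 8 -> context s -> stores p o s -> reg s x = i -> reg s y = j ->
  eval n (Cheapest x y) s = R i j && [forall r, R i r ==> (p j <= p r)].
Proof.
move=> ltx lty cs st rx ry; have r0 : reg s 0 = n by case: cs => -[].
apply: eval_and; first by apply: eval_allowed => //; lia.
apply: eval_all => r; rewrite implybE; apply: eval_or.
  by apply/eval_not/eval_allowed => //; [lia | registers].
apply: eval_leq; rewrite /eval -/eval eval_price_at //.
- by rewrite -(st j).1; registers; rewrite ry.
- by rewrite -(st r).1.
Qed.

(** A failing search for [r] leaves an index out of range in register 5, but the
    addresses written are past the adjacency matrix in any case. *)
Lemma bid_phase best s : phase best s -> phase best (den n Bid s).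
Proof.
move=> [cs r1]; rewrite /Bid den_then den_assign; set s1 := set_reg s 4 _.
have cs1 : context s1 by [].
rewrite den_when; case: ifP => // _; rewrite den_then den_assign.
set s2 := set_reg s1 5 _.
have cs2 : context s2 by [].
have r20 : reg s2 0 = n by case: cs2 => -[].
rewrite den_then !den_put eval_owner_at // eval_price_at //.
by split=> //; apply: context_heap; [lia | apply: context_heap; [lia |]].
Qed.

Lemma bid_step best p o s :
  phase best s -> stores p o s ->
  (forall u, unmatched o u -> exists r, R u r) ->
  (forall u, ~~ unmatched o u) /\ stores p o (den n Bid s) \/
  exists u r, [/\ unmatched o u, R u r, forall r', R u r' -> p r <= p r'
    & stores (raise p r) (assign o r u) (den n Bid s)].
Proof.
move=> [cs r1] st nbr; have r0 : reg s 0 = n by case: cs => -[].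
have pick_u := @eval_first n 9 4 (Unmatched 4) s (unmatched o) isT.
rewrite /Bid den_then den_assign den_when den_then den_assign den_then !den_put.
set s1 := set_reg s 4 _.
have r10 : reg s1 0 = n by [].
have guard k : reg s1 4 = k -> eval n (eNot (eLeq (Var 0) (Var 4))) s1 = (k < n).
  by move=> e; rewrite ltnNge; apply/eval_not/eval_leq.
have [a i|[u uu eu]|[none en]] := pick_u.
- exact: (eval_unmatched (p := p)).
- right; rewrite (guard _ eu) ltn_ord [nat_of_bool true == 0]/=.
  have pick_r := @eval_first n 9 5 (Cheapest 4 5) s1
    (fun j => R u j && [forall r, R u r ==> (p j <= p r)]) isT.
  set s2 := set_reg s1 5 _.
  have r20 : reg s2 0 = n by [].
  have [a j|[r /andP[Rur /forallP rmin] er]|[none _]] := pick_r.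
  + exact: (eval_cheapest (p := p) (o := o)).
  + exists u, r; split=> // [r' Rur'|k]; first by have := rmin r'; rewrite Rur'.
    have er' : reg s2 5 = r by [].
    rewrite eval_owner_at // eval_price_at // er' [reg _ 5]er'.
    have -> : eval n (Plus (Get (PriceAt 5)) (Num 1)) s2 = p r + 1.
      by rewrite /eval -/eval eval_price_at // er' (st r).1.
    have -> : eval n (Plus (Var 4) (Num 1)) (set_heap s2 (n * n + r) (p r + 1)) = u + 1.
      exact: (congr1 (addn^~ 1) eu).
    have [st1 st2] := st k; rewrite /raise /assign.
    have ltk := ltn_ord k; have ltr := ltn_ord r.
    case: (eqVneq k r) => [->|kr].
      by registers; rewrite !addn1.
    have kr' : (k == r :> nat) = false by apply: negPf.
    by registers; rewrite st1 st2 addn0.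
  + have [r0' Rr] := nbr _ uu.
    case: (@arg_minnP _ r0' (R u) p Rr) => j Ruj jmin.
    case/negP: (none j); rewrite Ruj; apply/forallP => r; apply/implyP; exact: jmin.
- by left; rewrite (guard _ en) ltnn.
Qed.

Lemma auction_phase best s :
  phase best s -> stores (fun=> 0) (fun=> None) s ->
  phase best (den n Auction s) /\
  (extendable G B -> exists p o, [/\ stores p o (den n Auction s),
     auction_inv R p o & forall u, ~~ unmatched o u]).
Proof.
move=> ph st.
(* As long as somebody is unmatched, the total price counts the bids. *)
pose J k s := phase best s /\ (extendable G B -> exists p o, [/\ stores p o s,
  auction_inv R p o & (forall u, ~~ unmatched o u) \/ \sum_r p r = k]).
have step k s1 : J k s1 -> J k.+1 (den n Bid s1).
  move=> [ph1 main]; split; first exact: bid_phase.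
  move=> ex; have [p [o [st1 inv alt]]] := main ex.
  have /extendableP[f f_inj Rf] := ex.
  case: (bid_step ph1 st1) => [u _|[all st2]|[u [r [uu Rur rmin st2]]]].
  - by exists (f u).
  - by exists p, o; split=> //; left.
  exists (raise p r), (assign o r u); split=> //; first exact: (auction_step f_inj Rf).
  right; rewrite sum_raise; case: alt => [all|->//].
  by rewrite (negPf (all u)) in uu.
have [ph' main] : J (n * n) (den n Auction s).
  apply: (@den_for n 6 (For 7 Bid) s (fun i => J (i * n))).
    split=> // _; exists (fun=> 0), (fun=> None); split=> //.
    by right; rewrite big1.
  move=> i s1 [ph1 main1]; rewrite mulSn addnC.
  apply: (@den_for n 7 Bid _ (fun j => J (i * n + j))).
    by rewrite addn0.
  by move=> j s2 Js2; rewrite addnS; apply: step.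
split=> // ex; have [p [o [st1 inv alt]]] := main ex; exists p, o; split=> //.
case: alt => // total u; apply/negP => uu.
have /extendableP[f f_inj Rf] := ex.
by have := auction_total inv uu; rewrite total card_ord ltnn.
Qed.

Lemma reset_phase best s :
  phase best s ->
  phase best (den n Reset s) /\ stores (fun=> 0) (fun=> None) (den n Reset s).
Proof.
move=> ph.
pose J k s := phase best s /\ forall r : 'I_n, r < k ->
  heap s (n * n + r) = 0 /\ heap s (n * n + r + n) = 0.
have [ph' z] : J n (den n Reset s).
  apply: den_for => [//|i s1 [[cs1 r1] z]].
  rewrite den_then !den_put; set s2 := set_reg s1 5 i.
  have r20 : reg s2 0 = n by case: cs1 => -[].
  rewrite eval_owner_at // eval_price_at // [reg _ 5]/= [reg _ 5]/=.
  split=> [|r ltr].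
    by split=> //; apply: context_heap; [lia | apply: context_heap; [lia |]].
  have ltrn := ltn_ord r; have ltin := ltn_ord i.
  rewrite /= !updateE !eqxx; case: (eqVneq (r : nat) i) => [->|ri].
    by rewrite !eqxx; registers.
  have [z1 z2] : heap s1 (n * n + r) = 0 /\ heap s1 (n * n + r + n) = 0.
    by apply: z; lia.
  by registers; rewrite z1 z2.
by split=> // r; apply: z.
Qed.

(** If the check succeeds it exhibits the injective map by itself, as a right
    vertex has only one owner; the auction matters for the converse. *)
Lemma check_extendable s :
  context s ->
  (extendable G B -> exists p o, [/\ stores p o s,
     auction_inv R p o & forall u, ~~ unmatched o u]) ->
  eval n Check s = extendable G B.
Proof.
move=> cs main; rewrite eval_check //; congr (nat_of_bool _); apply/forallP/idP.
  move=> all.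
  have /fin_all_exists[f fP] (u : 'I_n) :
      exists r : 'I_n, (heap s (n * n + r + n) == u + 1) && R u r.
    by apply/existsP; apply: all.
  apply/extendableP; exists f => [u u' e|u]; last by case/andP: (fP u).
  have /andP[/eqP h _] := fP u; have /andP[/eqP h' _] := fP u'.
  by apply: val_inj => /=; move: h'; rewrite -e h; lia.
move=> /main[p [o [st [_ ok _ _ _] matched]]] u; apply/existsP.
have := matched u; rewrite negb_forall => /existsP[r]; rewrite negbK => /eqP or.
by exists r; rewrite (st r).2 or /= addn1 eqxx; apply: ok.
Qed.

Lemma try_phase best s :
  phase best s -> phase (maxn best (value G v w)) (den n TryCandidate s).
Proof.
move=> /reset_phase[ph1 st1]; rewrite /TryCandidate !den_then.
have [ph2 ex2] := auction_phase ph1 st1; move: (den n Auction _) ph2 ex2 => s2 ph2 ex2.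
have [cs2 r2] := ph2; rewrite den_when check_extendable // /value.
case: (extendable G B); last by rewrite maxn0.
by rewrite den_assign; split=> //; rewrite -(eval_cut_size cs2) maxnE -r2.
Qed.

End Program.

Lemma program_correct n (G : sgraph 'I_n) :
  bipartite G -> radius_at_most G 2 ->
  let best := reg (den n Program (graph_input G)) 1 in
  max_disconnected_perfect_matching G (if best == 0 then None else Some best).
Proof.
move=> bG rad best; have n0 : 0 < n by case: rad => v _; apply: leq_trans (ltn_ord v).
have inp0 : holds_input G (graph_input G).
  split=> // i j; rewrite /graph_input /=; congr (nat_of_bool _).
  apply/existsP/idP => [[k /existsP[l /andP[/eqP e Gkl]]]|Gij]; last first.
    by exists i; apply/existsP; exists j; rewrite eqxx.
  have [ik jl] : (i = k :> nat) /\ (j = l :> nat).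
    have := ltn_ord j; have := ltn_ord l => ltl ltj.
    have := congr1 (divn ^~ n) e; have := congr1 (modn ^~ n) e.
    by rewrite !modnMDl !divnMDl // !modn_small // !divn_small // !addn0.
  by rewrite (val_inj ik) (val_inj jl).
pose J k s := [/\ holds_input G s,
  forall v w : 'I_n, v < k -> value G v w <= reg s 1 &
  reg s 1 = 0 \/ exists v w, reg s 1 = value G v w].
have [_ ub att] : J n (den n Program (graph_input G)).
  apply: (@den_for n 2 (For 3 TryCandidate) _ J) => [|v s [inp ub att]].
    by split=> //; left.
  pose L k s := [/\ holds_input G s, reg s 2 = v,
    forall v' w' : 'I_n, v' < v \/ v' = v /\ w' < k -> value G v' w' <= reg s 1 &
    reg s 1 = 0 \/ exists v w, reg s 1 = value G v w].
  have : L n (den n (For 3 TryCandidate) (set_reg s 2 v)).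
    apply: (@den_for n 3 TryCandidate _ L) => [|w s1 [inp1 r12 ub1 att1]].
      split=> // v' w' [lt|[]//]; exact: ub.
    have ph : phase G v w (reg s1 1) (set_reg s1 3 w) by split=> //; split.
    move: (den n TryCandidate _) (try_phase ph) => s2 [[inp2 r22 _] r21].
    split=> //.
      move=> v' w' h; rewrite r21 leq_max.
      case: (boolP ((v' < v) || (v' == v) && (w' < w))) => [/orP h'|].
        by rewrite ub1 //; case: h' => [|/andP[/eqP]]; auto.
      rewrite negb_or => /andP[h1 h2]; apply/orP; right.
      have [ev lew] : v' = v /\ w' <= w by case: h h1 => [->|[]].
      move: h2; rewrite ev eqxx /= => h2.
      by rewrite (_ : w' = w) //; apply: val_inj => /=; lia.
    rewrite r21; case: (leqP (value G v w) (reg s1 1)) => // _.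
    by right; exists v, w.
  move: (den n _ _) => s2 [inp' _ ub' att']; split=> // v' w' lt; apply: ub'.
  case: (ltngtP v' v) => [|gt|/val_inj ->]; [by left | by lia | by right].
by apply: max_value => // v w; apply: ub.
Qed.

Theorem theorem16 :
  solvable_in_polynomial_time
    (fun (n : nat) (G : sgraph 'I_n) => bipartite G /\ radius_at_most G 2)
    (fun (n : nat) (G : sgraph 'I_n) (r : option nat) =>
       max_disconnected_perfect_matching G r).
Proof.
apply: (loop_program_solves _ wf_Program) => // n G [bG rad].
exact: program_correct.
Qed.
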